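(* Let $P$ be an arbitrary set, let $\mathcal{L}^L\mathcal{S}$ be the category of the left strong monad freely generated by $P$ as set of generating objects, and let $\Delta$ be the simplicial category. Then the functor $G:\mathcal{L}^L\mathcal{S}\to\Delta$ defined in the context is faithful; i.e. for all objects $A,B$ and all arrows $f,g:A\to B$ of $\mathcal{L}^L\mathcal{S}$, if $Gf=Gg$, then $f=g$.
   Context: A monoidal category has a bifunctor $\otimes$, a unit object $I$ and natural isomorphisms $a_{A,B,C}:(A\otimes B)\otimes C\to A\otimes(B\otimes C)$, $l_A:I\otimes A\to A$, $r_A:A\otimes I\to A$ satisfying the usual coherence conditions. $\mathbf 1_A$ denotes the identity arrow of $A$. A left strong monad in a monoidal category $\mathcal A$ is a monad $\langle T,\eta,\mu\rangle$ in $\mathcal A$ (with $\eta_A:A\to TA$, $\mu_A:TTA\to TA$) together with a natural transformation with components $\psi^L_{A,B}:TA\otimes B\to T(A\otimes B)$ such that - $Ta_{A,B,C}\circ\psi^L_{A\otimes B,C}\circ(\psi^L_{A,B}\otimes\mathbf 1_C)=\psi^L_{A,B\otimes C}\circ a_{TA,B,C}$, - $Tr_A\circ\psi^L_{A,I}=r_{TA}$, - $\psi^L_{A,B}\circ(\eta_A\otimes\mathbf 1_B)=\eta_{A\otimes B}$, - $\psi^L_{A,B}\circ(\mu_A\otimes\mathbf 1_B)=\mu_{A\otimes B}\circ T\psi^L_{A,B}\circ\psi^L_{TA,B}$. $\mathcal{L}^L\mathcal{S}$ is the free such structure on $P$: its objects are the formal expressions (formulas) built from elements of $P$ and $I$ by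 $\otimes$ and $T$; its arrows are arrow terms built from identities, $a,a^{-1},l,l^{-1},r,r^{-1},\eta,\mu,\psi^L$ by $\circ$, $\otimes$ and $T$, modulo the congruence generated by the equations of categories, functoriality, naturality, monoidal categories, monads, and the four equations above. $\Delta$ is the category whose objects are the finite ordinals $n=\{0,\dots,n-1\}$ and whose arrows are the order-preserving (i.e. weakly monotone) functions. The functor $G$: $GA$ is the number of occurrences of $T$ in $A$; the elements $0,\dots,GA-1$ of $GA$ correspond to the occurrences of $T$ in $A$ counted from right to left. On arrow terms: $G$ of an identity, of $a_{A,B,C}$, $l_A$, $r_A$ and their inverses, and of $\psi^L_{A,B}$ is the identity function; $G\eta_A:GA\to GA+1$ is $i\mapsto i$; $G\mu_A:GA+2\to GA+1$ is $i\mapsto i$ for $i\le GA$ and $GA+1\mapsto GA$; $G(f\otimes g)$ is the juxtaposition of $Gf$ (on the left, i.e. on the larger elements) and $Gg$ (on the right, i.e. on the smaller elements); $GTf$ extends $Gf$ by sending the new leftmost (greatest) element of the source to the new leftmost (greatest) element of the target; $G(g\circ f)=Gg\circ Gf$. *)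

(* Defs.v *)
From HB Require Import structures.
From mathcomp Require Import all_boot zify.

Set Implicit Arguments.
Unset Strict Implicit.
Unset Printing Implicit Defensive.

(* Categories whose hom-types carry an explicit equality of arrows [heq], so
   that arrows may be terms taken modulo a congruence. *)
Record category := Category {
  obj :> Type;
  hom : obj -> obj -> Type;
  heq : forall A B : obj, hom A B -> hom A B -> Prop;
  idc : forall A : obj, hom A A;
  compc : forall A B C : obj, hom B C -> hom A B -> hom A C;
  heq_refl : forall (A B : obj) (f : hom A B), heq f f;
  heq_sym : forall (A B : obj) (f g : hom A B), heq f g -> heq g f;
  heq_trans : forall (A B : obj) (f g h : hom A B),
    heq f g -> heq g h -> heq f h;
  compc_heq : forall (A B C : obj) (g g' : hom B C) (f f' : hom A B),
    heq g g' -> heq f f' -> heq (compc g f) (compc g' f');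
  compc1l : forall (A B : obj) (f : hom A B), heq (compc (idc B) f) f;
  compc1r : forall (A B : obj) (f : hom A B), heq (compc f (idc A)) f;
  compcA : forall (A B C D : obj) (h : hom C D) (g : hom B C) (f : hom A B),
    heq (compc h (compc g f)) (compc (compc h g) f)
}.

Record functor (C D : category) := Functor {
  fobj :> C -> D;
  fhom : forall A B : C, hom A B -> hom (fobj A) (fobj B);
  fhom_heq : forall (A B : C) (f g : hom A B),
    heq f g -> heq (fhom f) (fhom g);
  fhom_id : forall A : C, heq (fhom (idc A)) (idc (fobj A));
  fhom_comp : forall (A B E : C) (g : hom B E) (f : hom A B),
    heq (fhom (compc g f)) (compc (fhom g) (fhom f))
}.

Definition faithful (C D : category) (F : functor C D) : Prop :=
  forall (A B : C) (f g : hom A B), heq (fhom F f) (fhom F g) -> heq f g.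

Inductive formula (P : Type) : Type :=
| Gen of P
| Unit
| Tens of formula P & formula P
| Mon of formula P.

Arguments Unit {P}.

Inductive term (P : Type) : formula P -> formula P -> Type :=
| Id A : term A A
| Comp A B C : term B C -> term A B -> term A C
| TensA A B C D : term A B -> term C D -> term (Tens A C) (Tens B D)
| MonA A B : term A B -> term (Mon A) (Mon B)
| Assoc A B C : term (Tens (Tens A B) C) (Tens A (Tens B C))
| AssocV A B C : term (Tens A (Tens B C)) (Tens (Tens A B) C)
| LUnit A : term (Tens Unit A) A
| LUnitV A : term A (Tens Unit A)
| RUnit A : term (Tens A Unit) A
| RUnitV A : term A (Tens A Unit)
| Eta A : term A (Mon A)
| Mu A : term (Mon (Mon A)) (Mon A)
| Psi A B : term (Tens (Mon A) B) (Mon (Tens A B)).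

Arguments Id {P} A.
Arguments Assoc {P} A B C.
Arguments AssocV {P} A B C.
Arguments LUnit {P} A.
Arguments LUnitV {P} A.
Arguments RUnit {P} A.
Arguments RUnitV {P} A.
Arguments Eta {P} A.
Arguments Mu {P} A.
Arguments Psi {P} A B.

Declare Scope lls_scope.
Delimit Scope lls_scope with lls.
Notation "A ⊗ B" := (Tens A B) (at level 40, left associativity) : lls_scope.
Notation "f ⊠ g" := (TensA f g) (at level 40, left associativity) : lls_scope.
Notation "g ∘ f" := (Comp g f) (at level 50, left associativity) : lls_scope.
Local Open Scope lls_scope.

Reserved Notation "f ≡ g" (at level 70, no associativity).

(* Arrows of the free structure are terms modulo [term_eq]. Coherence of the
   monoidal structure is given by the pentagon and the triangle; the other usual
   coherence equations (e.g. l_I = r_I) follow. *)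
Inductive term_eq (P : Type) :
  forall A B : formula P, term A B -> term A B -> Prop :=
| Eq_refl A B (f : term A B) : f ≡ f
| Eq_sym A B (f g : term A B) : f ≡ g -> g ≡ f
| Eq_trans A B (f g h : term A B) : f ≡ g -> g ≡ h -> f ≡ h
| Eq_comp A B C (g g' : term B C) (f f' : term A B) :
    g ≡ g' -> f ≡ f' -> g ∘ f ≡ g' ∘ f'
| Eq_tens A B C D (f f' : term A B) (g g' : term C D) :
    f ≡ f' -> g ≡ g' -> f ⊠ g ≡ f' ⊠ g'
| Eq_mon A B (f f' : term A B) : f ≡ f' -> MonA f ≡ MonA f'
| Eq_comp1l A B (f : term A B) : Id B ∘ f ≡ f
| Eq_comp1r A B (f : term A B) : f ∘ Id A ≡ f
| Eq_compA A B C D (h : term C D) (g : term B C) (f : term A B) :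
    h ∘ (g ∘ f) ≡ (h ∘ g) ∘ f
| Eq_tens1 A B : Id A ⊠ Id B ≡ Id (A ⊗ B)
| Eq_tens_comp A B C A' B' C' (g : term B C) (f : term A B)
    (g' : term B' C') (f' : term A' B') :
    (g ∘ f) ⊠ (g' ∘ f') ≡ (g ⊠ g') ∘ (f ⊠ f')
| Eq_mon1 A : MonA (Id A) ≡ Id (Mon A)
| Eq_mon_comp A B C (g : term B C) (f : term A B) :
    MonA (g ∘ f) ≡ MonA g ∘ MonA f
| Eq_assoc_nat A B C A' B' C' (f : term A A') (g : term B B')
    (h : term C C') :
    (f ⊠ (g ⊠ h)) ∘ Assoc A B C ≡ Assoc A' B' C' ∘ ((f ⊠ g) ⊠ h)
| Eq_lunit_nat A B (f : term A B) :
    f ∘ LUnit A ≡ LUnit B ∘ (Id Unit ⊠ f)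
| Eq_runit_nat A B (f : term A B) :
    f ∘ RUnit A ≡ RUnit B ∘ (f ⊠ Id Unit)
| Eq_eta_nat A B (f : term A B) : MonA f ∘ Eta A ≡ Eta B ∘ f
| Eq_mu_nat A B (f : term A B) : MonA f ∘ Mu A ≡ Mu B ∘ MonA (MonA f)
| Eq_psi_nat A B A' B' (f : term A A') (g : term B B') :
    MonA (f ⊠ g) ∘ Psi A B ≡ Psi A' B' ∘ (MonA f ⊠ g)
| Eq_assocK A B C : AssocV A B C ∘ Assoc A B C ≡ Id ((A ⊗ B) ⊗ C)
| Eq_assocVK A B C : Assoc A B C ∘ AssocV A B C ≡ Id (A ⊗ (B ⊗ C))
| Eq_lunitK A : LUnitV A ∘ LUnit A ≡ Id (Unit ⊗ A)
| Eq_lunitVK A : LUnit A ∘ LUnitV A ≡ Id A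
| Eq_runitK A : RUnitV A ∘ RUnit A ≡ Id (A ⊗ Unit)
| Eq_runitVK A : RUnit A ∘ RUnitV A ≡ Id A
| Eq_pentagon A B C D :
    Assoc A B (C ⊗ D) ∘ Assoc (A ⊗ B) C D
    ≡ (Id A ⊠ Assoc B C D) ∘ Assoc A (B ⊗ C) D ∘ (Assoc A B C ⊠ Id D)
| Eq_triangle A B :
    (Id A ⊠ LUnit B) ∘ Assoc A Unit B ≡ RUnit A ⊠ Id B
| Eq_mu_assoc A : Mu A ∘ MonA (Mu A) ≡ Mu A ∘ Mu (Mon A)
| Eq_mu_eta A : Mu A ∘ Eta (Mon A) ≡ Id (Mon A)
| Eq_mu_mon_eta A : Mu A ∘ MonA (Eta A) ≡ Id (Mon A)
| Eq_psi_assoc A B C :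
    MonA (Assoc A B C) ∘ Psi (A ⊗ B) C ∘ (Psi A B ⊠ Id C)
    ≡ Psi A (B ⊗ C) ∘ Assoc (Mon A) B C
| Eq_psi_unit A : MonA (RUnit A) ∘ Psi A Unit ≡ RUnit (Mon A)
| Eq_psi_eta A B : Psi A B ∘ (Eta A ⊠ Id B) ≡ Eta (A ⊗ B)
| Eq_psi_mu A B :
    Psi A B ∘ (Mu A ⊠ Id B) ≡ Mu (A ⊗ B) ∘ MonA (Psi A B) ∘ Psi (Mon A) B
where "f ≡ g" := (term_eq f g) : lls_scope.

Definition LLS (P : Type) : category :=
  @Category (formula P) (@term P) (@term_eq P) (@Id P) (@Comp P)
    (@Eq_refl P) (@Eq_sym P) (@Eq_trans P) (@Eq_comp P)
    (@Eq_comp1l P) (@Eq_comp1r P) (@Eq_compA P).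

Definition monotone m n (f : {ffun 'I_m -> 'I_n}) : bool :=
  [forall i : 'I_m, forall j : 'I_m, (i <= j) ==> (f i <= f j)].

Record delta (m n : nat) := Delta_arr {
  dfun :> {ffun 'I_m -> 'I_n};
  dfun_mono : monotone dfun
}.
HB.instance Definition _ m n := [isSub for @dfun m n].

Lemma deltaP m n (f g : delta m n) : (forall i, f i = g i :> nat) -> f = g.
Proof. by move=> fg; apply/val_inj/ffunP=> i; apply/val_inj/fg. Qed.

Lemma delta_mono m n (f : delta m n) : {homo f : i j / i <= j}.
Proof. by move=> i j; move/forallP/(_ i)/forallP/(_ j)/implyP: (dfun_mono f). Qed.

Lemma monotone_finfun m n (h : 'I_m -> 'I_n) :
  {homo h : i j / i <= j} -> monotone (finfun h).
Proof.
by move=> hh; apply/forallP=> i; apply/forallP=> j; rewrite !ffunE; apply/implyP/hh.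
Qed.

Definition mk_delta m n (h : 'I_m -> 'I_n) (hh : {homo h : i j / i <= j}) :
  delta m n := Delta_arr (monotone_finfun hh).

Lemma mk_deltaE m n h hh i : @mk_delta m n h hh i = h i.
Proof. by rewrite /mk_delta /= ffunE. Qed.

Definition delta_id m : delta m m :=
  @mk_delta m m id (fun i j => id).

Lemma delta_comp_subproof m n p (g : delta n p) (f : delta m n) :
  {homo g \o f : i j / i <= j}.
Proof. by move=> i j ij; do 2!apply: delta_mono. Qed.

Definition delta_comp m n p (g : delta n p) (f : delta m n) : delta m p :=
  mk_delta (delta_comp_subproof g f).

Lemma delta_idE m i : delta_id m i = i.
Proof. exact: mk_deltaE. Qed.

Lemma delta_compE m n p (g : delta n p) (f : delta m n) i :
  delta_comp g f i = g (f i).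
Proof. exact: mk_deltaE. Qed.

Definition Delta : category.
Proof.
refine (@Category nat delta (fun m n => @eq (delta m n)) delta_id delta_comp
  _ _ _ _ _ _ _).
- by [].
- by move=> m n f g ->.
- by move=> m n f g h -> ->.
- by move=> m n p g _ f _ <- <-.
- by move=> m n f; apply: deltaP=> i; rewrite delta_compE delta_idE.
- by move=> m n f; apply: deltaP=> i; rewrite delta_compE delta_idE.
- by move=> m n p q h g f; apply: deltaP=> i; rewrite !delta_compE.
Defined.

(* The identity function i |-> i, between ordinals that are equal but not
   convertible. *)
Lemma delta_cast_subproof m n (e : m = n) : {homo cast_ord e : i j / i <= j}.
Proof. by []. Qed.

Definition delta_cast m n (e : m = n) : delta m n :=
  mk_delta (delta_cast_subproof e).

Lemma delta_castE m n (e : m = n) i : delta_cast e i = i :> nat.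
Proof. by rewrite /delta_cast mk_deltaE. Qed.

(* Juxtaposition of f and g: the smaller elements, mapped by g, are the left
   summand [lshift] of 'I_(p + m); the larger ones, mapped by f, are the right
   summand [rshift]. *)
Definition juxt_fun m n p q (f : 'I_m -> 'I_n) (g : 'I_p -> 'I_q)
    (i : 'I_(p + m)) : 'I_(q + n) :=
  match split i with
  | inl j => lshift n (g j)
  | inr k => rshift q (f k)
  end.

Lemma juxt_fun_subproof m n p q (f : delta m n) (g : delta p q) :
  {homo juxt_fun f g : i j / i <= j}.
Proof.
move=> i j; rewrite /juxt_fun.
case: (split_ordP i) => i' ->; case: (split_ordP j) => j' -> /=.
- exact: delta_mono.
- by move=> _; apply: leq_trans (ltnW (ltn_ord (g i'))) (leq_addr _ _).
- by rewrite leqNgt (leq_trans (ltn_ord j') (leq_addr _ _)).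
- by rewrite !leq_add2l; apply: delta_mono.
Qed.

Definition delta_juxt m n p q (f : delta m n) (g : delta p q) :
  delta (p + m) (q + n) := mk_delta (juxt_fun_subproof f g).

Lemma delta_juxtl m n p q (f : delta m n) (g : delta p q) j :
  delta_juxt f g (lshift m j) = lshift n (g j).
Proof.
rewrite /delta_juxt mk_deltaE /juxt_fun.
by rewrite (unsplitK (inl j : 'I_p + 'I_m)%type).
Qed.

Lemma delta_juxtr m n p q (f : delta m n) (g : delta p q) k :
  delta_juxt f g (rshift p k) = rshift q (f k).
Proof.
rewrite /delta_juxt mk_deltaE /juxt_fun.
by rewrite (unsplitK (inr k : 'I_p + 'I_m)%type).
Qed.

(* Extension of f by a new greatest element: [unlift ord_max i] is [None] when
   i is the greatest element of 'I_m.+1, and [Some j] with j = i otherwise. *)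
Definition top_fun m n (f : 'I_m -> 'I_n) (i : 'I_m.+1) : 'I_n.+1 :=
  if unlift ord_max i is Some j then widen_ord (leqnSn n) (f j) else ord_max.

Lemma bump_max m (i : 'I_m) : bump m i = i.
Proof. by rewrite /bump leqNgt ltn_ord. Qed.

Lemma top_fun_subproof m n (f : delta m n) : {homo top_fun f : i j / i <= j}.
Proof.
move=> i j; rewrite /top_fun.
case: (unliftP ord_max i) => [i'|] ->; case: (unliftP ord_max j) => [j'|] -> //=.
- by rewrite !bump_max; apply: delta_mono.
- by move=> _; apply/ltnW.
- by rewrite bump_max leqNgt ltn_ord.
Qed.

Definition delta_top m n (f : delta m n) : delta m.+1 n.+1 :=
  mk_delta (top_fun_subproof f).

Lemma delta_eta_subproof n : {homo widen_ord (leqnSn n) : i j / i <= j}.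
Proof. by []. Qed.

Definition delta_eta n : delta n n.+1 := mk_delta (@delta_eta_subproof n).

(* The minimum encodes: i |-> i for i <= n, and n.+1 |-> n. *)
Lemma delta_mu_subproof n :
  {homo (fun i : 'I_n.+2 => inord (minn i n) : 'I_n.+1) : i j / i <= j}.
Proof.
move=> i j ij; rewrite !inordK ?ltnS ?geq_minr //.
by rewrite leq_min geq_minr andbT (leq_trans (geq_minl _ _)).
Qed.

Definition delta_mu n : delta n.+2 n.+1 := mk_delta (@delta_mu_subproof n).

(* Number of occurrences of T. Occurrences are counted from right to left, so
   those of B come first in A ⊗ B, and the new T of T A is the last one. *)
Fixpoint countT (P : Type) (A : formula P) : nat :=
  match A with
  | Gen _ => 0
  | Unit => 0
  | Tens A1 A2 => countT A2 + countT A1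
  | Mon A1 => (countT A1).+1
  end.

Fixpoint G_term (P : Type) (A B : formula P) (f : term A B) :
    delta (countT A) (countT B) :=
  match f in term A B return delta (countT A) (countT B) with
  | Id A => delta_id (countT A)
  | Comp _ _ _ g f => delta_comp (G_term g) (G_term f)
  | TensA _ _ _ _ f g => delta_juxt (G_term f) (G_term g)
  | MonA _ _ f => delta_top (G_term f)
  | Assoc A B C => delta_cast (addnA (countT C) (countT B) (countT A))
  | AssocV A B C => delta_cast (esym (addnA (countT C) (countT B) (countT A)))
  | LUnit A => delta_cast (addn0 (countT A))
  | LUnitV A => delta_cast (esym (addn0 (countT A)))
  | RUnit A => delta_cast (add0n (countT A))
  | RUnitV A => delta_cast (esym (add0n (countT A)))
  | Eta A => delta_eta (countT A)
  | Mu A => delta_mu (countT A)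
  | Psi A B => delta_cast (addnS (countT B) (countT A))
  end.

Definition val_at m n (f : delta m n) (i : nat) : nat :=
  if insub i is Some j then f j : nat else 0.

Lemma val_atE m n (f : delta m n) (i : 'I_m) : val_at f i = f i.
Proof. by rewrite /val_at valK. Qed.

Lemma val_at_lt m n (f : delta m n) i : i < m -> val_at f i < n.
Proof. by move=> im; rewrite -[i]/(val (Ordinal im)) val_atE. Qed.

Lemma val_atP m n (f g : delta m n) :
  (forall i, i < m -> val_at f i = val_at g i) -> f = g.
Proof. by move=> fg; apply: deltaP=> i; rewrite -!val_atE fg. Qed.

Lemma val_at_id m i : i < m -> val_at (delta_id m) i = i.
Proof. by move=> im; rewrite -[i]/(val (Ordinal im)) val_atE delta_idE. Qed.

Lemma val_at_comp m n p (g : delta n p) (f : delta m n) i :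
  i < m -> val_at (delta_comp g f) i = val_at g (val_at f i).
Proof. by move=> im; rewrite -[i]/(val (Ordinal im)) !val_atE delta_compE. Qed.

Lemma val_at_cast m n (e : m = n) i : i < m -> val_at (delta_cast e) i = i.
Proof. by move=> im; rewrite -[i]/(val (Ordinal im)) val_atE delta_castE. Qed.

Lemma val_at_juxt m n p q (f : delta m n) (g : delta p q) i : i < p + m ->
  val_at (delta_juxt f g) i = if i < p then val_at g i else q + val_at f (i - p).
Proof.
move=> im; rewrite -[i]/(val (Ordinal im)) val_atE.
case: (split_ordP (Ordinal im)) => j ->.
  by rewrite delta_juxtl val_atE.
by rewrite delta_juxtr /= addKn val_atE.
Qed.

Lemma val_at_top m n (f : delta m n) i : i < m.+1 ->
  val_at (delta_top f) i = if i < m then val_at f i else n.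
Proof.
move=> im; rewrite -[i]/(val (Ordinal im)) val_atE mk_deltaE /top_fun.
case: (unliftP ord_max (Ordinal im)) => [j|] -> /=; last by rewrite ltnn.
by rewrite bump_max ltn_ord val_atE.
Qed.

Lemma val_at_eta n i : i < n -> val_at (delta_eta n) i = i.
Proof. by move=> im; rewrite -[i]/(val (Ordinal im)) val_atE mk_deltaE. Qed.

Lemma val_at_mu n i : i < n.+2 -> val_at (delta_mu n) i = minn i n.
Proof.
move=> im; rewrite -[i]/(val (Ordinal im)) val_atE mk_deltaE.
by rewrite inordK // ltnS geq_minr.
Qed.

(* Evaluates innermost values first, splitting the conditionals as they appear,
   so that the bounds required by the lemmas above are in the context. *)
Ltac evaluated i :=
  lazymatch i with
  | context [val_at (G_term _) _] => idtac
  | context [val_at _ _] => fail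
  | _ => idtac
  end.

Ltac val_at_step :=
  match goal with
  | |- context [if ?b then _ else _] => case: (boolP b) => ?
  | |- context [val_at (delta_comp ?g ?f) ?i] => rewrite (@val_at_comp _ _ _ g f i)
  | |- context [val_at (delta_id ?m) ?i] => evaluated i; rewrite (@val_at_id m i)
  | |- context [val_at (delta_cast ?e) ?i] =>
    evaluated i; rewrite (@val_at_cast _ _ e i)
  | |- context [val_at (delta_juxt ?f ?g) ?i] =>
    evaluated i; rewrite (@val_at_juxt _ _ _ _ f g i)
  | |- context [val_at (delta_top ?f) ?i] => evaluated i; rewrite (@val_at_top _ _ f i)
  | |- context [val_at (delta_eta ?m) ?i] => evaluated i; rewrite (@val_at_eta m i)
  | |- context [val_at (delta_mu ?m) ?i] => evaluated i; rewrite (@val_at_mu m i)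
  end.

Ltac val_at_bounds :=
  repeat match goal with
  | |- context [val_at (G_term ?f) ?i] =>
    let x := fresh "x" in
    move: (@val_at_lt _ _ (G_term f) i);
    set x := val_at (G_term f) i; clearbody x
  | H : context [val_at (G_term ?f) ?i] |- _ => move: H
  end.

Lemma G_term_eq (P : Type) (A B : formula P) (f g : term A B) :
  (f ≡ g)%lls -> G_term f = G_term g.
Proof.
elim=> {A B f g} /=; try by move=> *; congruence.
all: intros; apply: val_atP => i; rewrite /= => im.
all: repeat val_at_step.
all: try lia.
all: try (val_at_bounds; lia).
- by rewrite addKn.
- by rewrite subnDA addnA.
- by rewrite subn0.
- have iA : i <= countT A by lia.
  have := @val_at_lt _ _ (G_term f) i.
  by rewrite (minn_idPl iA); lia.
Qed.

Definition G (P : Type) : functor (LLS P) Delta :=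
  @Functor (LLS P) Delta (@countT P) (@G_term P) (@G_term_eq P)
    (fun A => erefl) (fun A B E g f => erefl).

(* Main.v *)
From mathcomp Require Import all_boot zify.
From Stdlib Require Import Setoid Morphisms Eqdep.
Require Import Defs.

(** Erasing associativity and units turns a formula into a list of atoms, an
    atom being a generator or some [Mon A]; the list is a left-hand side of a
    sequent calculus whose proofs are arrows. Its rules (predicate [NF]) are the
    axioms for a generator and for the unit, the right rule for the tensor
    product, the right rule for [Mon], which composes with [Eta], and the left
    rule for [Mon], which turns [h : A ⊗ C -> Mon B] into its strong Kleisli
    extension [lin h = Mu ∘ (MonA h ∘ Psi) : Mon A ⊗ C -> Mon B]. The left rule
    applies only to the first atom, because the strength is a left one.

    Every arrow is in normal form once its source is flattened ([NF_unflat],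
    [NF_comp]). No cut elimination is needed for this: normal forms are stable under composition on the left
    with each primitive arrow, because inverting the last rules of the normal
    form makes the defining equation of the primitive arrow applicable (for
    example, [Mu ∘ Eta = Id] when [Mu] meets a right rule, and [Mu ∘ lin h =
    lin (Mu ∘ h)] when it meets a left rule).

    The normal form is then read off from the order-preserving function
    ([NF_unique]). For a target [B ⊗ C], the point where the list is cut in two
    is determined by the number of generators of [B] and by the number of
    occurrences of T that are mapped into [C]. For a target [Mon B], the
    greatest element of the codomain is a value of the function exactly when
    the last rule is the left one ([G_eta_lin]); in one case the premise is
    recovered because the image of [Eta] is injective, in the other because
    [lin h ∘ (Eta ⊠ Id) = h]. *)

Set Implicit Arguments.
Unset Strict Implicit.
Unset Printing Implicit Defensive.

Local Open Scope lls_scope.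

#[local] Instance term_eq_equiv P A B : Equivalence (@term_eq P A B).
Proof.
split; [exact: Eq_refl | move=> f g; exact: Eq_sym | move=> f g h; exact: Eq_trans].
Qed.

#[local] Instance Comp_proper P A B C :
  Proper (@term_eq P B C ==> @term_eq P A B ==> @term_eq P A C) (@Comp P A B C).
Proof. by move=> g g' ? f f' ?; apply: Eq_comp. Qed.

#[local] Instance TensA_proper P A B C D :
  Proper (@term_eq P A B ==> @term_eq P C D ==> @term_eq P (A ⊗ C) (B ⊗ D))
         (@TensA P A B C D).
Proof. by move=> g g' ? f f' ?; apply: Eq_tens. Qed.

#[local] Instance MonA_proper P A B :
  Proper (@term_eq P A B ==> @term_eq P (Mon A) (Mon B)) (@MonA P A B).
Proof. by move=> f f' ?; apply: Eq_mon. Qed.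

#[local] Hint Resolve Eq_refl : core.

(** * Equational reasoning with terms *)

Section Equations.
Variable P : Type.
Implicit Types A B C D : formula P.

Lemma compA A B C D (h : term C D) (g : term B C) (f : term A B) :
  (h ∘ g) ∘ f ≡ h ∘ (g ∘ f).
Proof. by symmetry; apply: Eq_compA. Qed.

Lemma comp_ext A B C C' (g : term B C) (f : term A B) (h : term A C)
    (k : term C' A) : g ∘ f ≡ h -> g ∘ (f ∘ k) ≡ h ∘ k.
Proof. by move=> <-; rewrite compA. Qed.

Lemma comp_ext2 A B C D C' (g : term C D) (f : term B C) (e : term A B)
    (h : term A D) (k : term C' A) : g ∘ (f ∘ e) ≡ h -> g ∘ (f ∘ (e ∘ k)) ≡ h ∘ k.
Proof. by move=> <-; rewrite !compA. Qed.

Lemma tens_comp A B C A' B' C' (g : term B C) (f : term A B)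
    (g' : term B' C') (f' : term A' B') :
  (g ⊠ g') ∘ (f ⊠ f') ≡ (g ∘ f) ⊠ (g' ∘ f').
Proof. by symmetry; apply: Eq_tens_comp. Qed.

Lemma mon_comp A B C (g : term B C) (f : term A B) :
  MonA g ∘ MonA f ≡ MonA (g ∘ f).
Proof. by symmetry; apply: Eq_mon_comp. Qed.

End Equations.

Ltac norm := rewrite ?compA ?Eq_comp1l ?Eq_comp1r.

(* Composites are kept nested to the right. An equation whose left-hand side is
   a composite then occurs either as the innermost pair, or with a remainder. *)
Ltac crw E := first [rewrite E | rewrite (comp_ext _ E)]; norm.
Ltac crwr E := first [rewrite -E | rewrite (comp_ext _ (Eq_sym E))]; norm.

Ltac fuse :=
  repeat (first [rewrite tens_comp | rewrite (comp_ext _ (tens_comp _ _ _ _))]; norm).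

(** * Consequences of the pentagon and the triangle *)

Section Coherence.
Variable P : Type.
Implicit Types A B C D : formula P.

Lemma comp_cancelr A B C (g g' : term B C) (f : term A B) (k : term B A) :
  f ∘ k ≡ Id B -> g ∘ f ≡ g' ∘ f -> g ≡ g'.
Proof.
by move=> fk e; rewrite -[g]Eq_comp1r -[g']Eq_comp1r -fk Eq_compA e compA.
Qed.

Lemma comp_cancell A B C (g : term B C) (k : term C B) (f f' : term A B) :
  k ∘ g ≡ Id B -> g ∘ f ≡ g ∘ f' -> f ≡ f'.
Proof.
by move=> kg e; rewrite -[f]Eq_comp1l -[f']Eq_comp1l -kg compA e Eq_compA.
Qed.

Lemma tens_unitl_inj A B (f g : term A B) : Id Unit ⊠ f ≡ Id Unit ⊠ g -> f ≡ g.
Proof.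
move=> e; apply: (comp_cancelr (Eq_lunitVK A)).
by rewrite !Eq_lunit_nat e.
Qed.

Lemma tens_unitr_inj A B (f g : term A B) : f ⊠ Id Unit ≡ g ⊠ Id Unit -> f ≡ g.
Proof.
move=> e; apply: (comp_cancelr (Eq_runitVK A)).
by rewrite !Eq_runit_nat e.
Qed.

Lemma tens_inv A B C D (f : term A B) (f' : term B A) (g : term C D)
    (g' : term D C) :
  f ∘ f' ≡ Id B -> g ∘ g' ≡ Id D -> (f ⊠ g) ∘ (f' ⊠ g') ≡ Id (B ⊗ D).
Proof. by move=> e e'; rewrite tens_comp e e' Eq_tens1. Qed.

Lemma assocV_nat A B C A' B' C' (f : term A A') (g : term B B') (h : term C C') :
  ((f ⊠ g) ⊠ h) ∘ AssocV A B C ≡ AssocV A' B' C' ∘ (f ⊠ (g ⊠ h)).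
Proof.
apply: (comp_cancelr (Eq_assocVK A B C)); norm.
by rewrite Eq_assocK; norm; crw (Eq_assoc_nat f g h); crw (Eq_assocK A' B' C').
Qed.

Lemma lunitV_nat A B (f : term A B) : (Id Unit ⊠ f) ∘ LUnitV A ≡ LUnitV B ∘ f.
Proof.
apply: (comp_cancelr (Eq_lunitVK A)); norm.
by rewrite Eq_lunitK Eq_lunit_nat; norm; crw (Eq_lunitK B).
Qed.

Lemma runitV_nat A B (f : term A B) : (f ⊠ Id Unit) ∘ RUnitV A ≡ RUnitV B ∘ f.
Proof.
apply: (comp_cancelr (Eq_runitVK A)); norm.
by rewrite Eq_runitK Eq_runit_nat; norm; crw (Eq_runitK B).
Qed.

(** Tensoring with the unit object is injective on arrows, so it suffices to
    prove the equation tensored with [Id Unit] on the left; there it is a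
    pentagon with two unit objects, simplified by two triangles. *)
Lemma lunit_tens A B : LUnit (A ⊗ B) ∘ Assoc Unit A B ≡ LUnit A ⊠ Id B.
Proof.
apply: tens_unitl_inj.
apply: (comp_cancelr (Eq_assocVK Unit (Unit ⊗ A) B)).
apply: (comp_cancelr (tens_inv (Eq_assocVK Unit Unit A) (Eq_comp1l (Id B)))).
have e : (Id Unit ⊠ Assoc Unit A B) ∘
    (Assoc Unit (Unit ⊗ A) B ∘ (Assoc Unit Unit A ⊠ Id B))
  ≡ Assoc Unit Unit (A ⊗ B) ∘ Assoc (Unit ⊗ Unit) A B.
  by rewrite Eq_pentagon compA.
rewrite -[Id Unit in X in X ≡ _]Eq_comp1l -tens_comp; norm; rewrite e.
crw (Eq_triangle Unit (A ⊗ B)); rewrite -Eq_tens1.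
rewrite Eq_assoc_nat -Eq_triangle; crw (Eq_assoc_nat (Id Unit) (LUnit A) (Id B)).
by rewrite tens_comp Eq_comp1l.
Qed.

(** The mirror image of [lunit_tens], with the pentagon on [A], [B] and two
    unit objects. *)
Lemma runit_tens A B : (Id A ⊠ RUnit B) ∘ Assoc A B Unit ≡ RUnit (A ⊗ B).
Proof.
apply: tens_unitr_inj; apply: (comp_cancell (Eq_assocK A B Unit)).
transitivity ((Id A ⊠ (Id B ⊠ LUnit Unit)) ∘ ((Id A ⊠ Assoc B Unit Unit) ∘
    (Assoc A (B ⊗ Unit) Unit ∘ (Assoc A B Unit ⊠ Id Unit)))).
  rewrite (comp_ext _ (tens_comp _ _ _ _)) Eq_triangle Eq_comp1l.
  crw (Eq_assoc_nat (Id A) (RUnit B) (Id Unit)).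
  by rewrite tens_comp Eq_comp1l.
have -> : (Id A ⊠ Assoc B Unit Unit) ∘
    (Assoc A (B ⊗ Unit) Unit ∘ (Assoc A B Unit ⊠ Id Unit))
  ≡ Assoc A B (Unit ⊗ Unit) ∘ Assoc (A ⊗ B) Unit Unit.
  by rewrite Eq_pentagon compA.
crw (Eq_assoc_nat (Id A) (Id B) (LUnit Unit)).
by rewrite Eq_tens1 Eq_triangle.
Qed.

(** After tensoring with [Id Unit], both sides are [(Id ⊠ l) ∘ a]: one by
    [lunit_tens] and naturality, the other by the triangle. *)
Lemma lunit_unit : LUnit (@Unit P) ≡ RUnit Unit.
Proof.
apply: tens_unitr_inj; rewrite -lunit_tens -Eq_triangle.
suff -> : LUnit (Unit ⊗ @Unit P) ≡ Id Unit ⊠ LUnit Unit by [].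
by apply: (comp_cancell (Eq_lunitK Unit)); rewrite Eq_lunit_nat.
Qed.

End Coherence.

(** * Contexts *)

Section Contexts.
Variable P : Type.
Implicit Types A B C D : formula P.

(** Atoms are separated from formulas so that a context has no unit or tensor
    left to decompose. *)
Inductive atom := AGen of P | AMon of formula P.

Definition atomF (x : atom) : formula P :=
  match x with AGen p => Gen p | AMon A => Mon A end.

Implicit Types Γ Δ Θ : seq atom.

Fixpoint ctx Γ : formula P :=
  if Γ is x :: Γ' then atomF x ⊗ ctx Γ' else Unit.

Fixpoint flat A : seq atom :=
  match A with
  | Gen p => [:: AGen p]
  | Unit => [::]
  | B ⊗ C => flat B ++ flat C
  | Mon B => [:: AMon B]
  end.

(** Contexts that are equal but not convertible, such as the two bracketings of
    a concatenation, are related by transported identities. *)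
Definition castS Γ Γ' (e : Γ = Γ') : term (ctx Γ) (ctx Γ') :=
  match e in _ = Δ return term (ctx Γ) (ctx Δ) with erefl => Id (ctx Γ) end.

(** Uniqueness of identity proofs cannot be avoided here: the identity of
    [Gen p] transported along a nontrivial loop at [p] would be an arrow with the
    same image in the simplicial category as the identity, but not equal to it. *)
Lemma castS_id Γ (e : Γ = Γ) : castS e = Id (ctx Γ).
Proof. by rewrite (UIP_refl _ _ e). Qed.

Lemma castS_cons x Γ Γ' (e : Γ = Γ') :
  castS (f_equal (cons x) e) ≡ Id (atomF x) ⊠ castS e.
Proof. by case: _ / e; rewrite /= Eq_tens1. Qed.

Lemma castSK Γ Γ' (e : Γ = Γ') : castS e ∘ castS (esym e) ≡ Id (ctx Γ').
Proof. by case: _ / e; rewrite /= Eq_comp1l. Qed.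

Fixpoint uncat Γ Δ : term (ctx (Γ ++ Δ)) (ctx Γ ⊗ ctx Δ) :=
  match Γ return term (ctx (Γ ++ Δ)) (ctx Γ ⊗ ctx Δ) with
  | [::] => LUnitV (ctx Δ)
  | x :: Γ' => AssocV (atomF x) (ctx Γ') (ctx Δ) ∘ (Id (atomF x) ⊠ uncat Γ' Δ)
  end.

Lemma uncat_inv Γ Δ : exists j, uncat Γ Δ ∘ j ≡ Id (ctx Γ ⊗ ctx Δ).
Proof.
elim: Γ => [|x Γ [j jP]] /=; first by exists (LUnit (ctx Δ)); rewrite Eq_lunitK.
exists ((Id _ ⊠ j) ∘ Assoc _ _ _); norm.
by crw (tens_inv (Eq_comp1l (Id (atomF x))) jP); rewrite Eq_assocK.
Qed.

(** Cutting off an empty right part adds a unit object only; with [uncat_assoc]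
    and the computation rule for an empty left part this says that [uncat] is a
    coherent comparison between concatenation and tensor product. *)
Lemma uncat_nil Γ : exists e : Γ ++ [::] = Γ, RUnit (ctx Γ) ∘ uncat Γ [::] ≡ castS e.
Proof.
elim: Γ => [|x Γ [e eP]] /=.
  by exists erefl; rewrite -lunit_unit Eq_lunitVK.
exists (f_equal (cons x) e); rewrite castS_cons -runit_tens; norm.
crw (Eq_assocVK (atomF x) (ctx Γ) Unit).
by rewrite tens_comp eP Eq_comp1l.
Qed.

Lemma uncat_assoc Γ Δ Θ : exists e : Γ ++ (Δ ++ Θ) = (Γ ++ Δ) ++ Θ,
  Assoc (ctx Γ) (ctx Δ) (ctx Θ) ∘ ((uncat Γ Δ ⊠ Id (ctx Θ)) ∘
     (uncat (Γ ++ Δ) Θ ∘ castS e))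
  ≡ (Id (ctx Γ) ⊠ uncat Δ Θ) ∘ uncat Γ (Δ ++ Θ).
Proof.
elim: Γ => [|x Γ [e eP]] /=.
  exists erefl; rewrite /= lunitV_nat; norm; apply: (comp_cancell (Eq_lunitK _)).
  crw (lunit_tens (ctx Δ) (ctx Θ)).
  rewrite (comp_ext _ (tens_comp _ _ _ _)) Eq_lunitVK Eq_comp1l Eq_tens1; norm.
  by crw (Eq_lunitVK (ctx Δ ⊗ ctx Θ)).
exists (f_equal (cons x) e); rewrite castS_cons; norm.
set X := atomF x; set s := uncat Γ Δ.
(* The pentagon, with the associators at the ends moved across. *)
have pent : Assoc (X ⊗ ctx Γ) (ctx Δ) (ctx Θ) ∘
   ((AssocV X (ctx Γ) (ctx Δ) ⊠ Id (ctx Θ)) ∘ AssocV X (ctx Γ ⊗ ctx Δ) (ctx Θ))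
   ≡ AssocV X (ctx Γ) (ctx Δ ⊗ ctx Θ) ∘ (Id X ⊠ Assoc (ctx Γ) (ctx Δ) (ctx Θ)).
  apply: (comp_cancelr (Eq_assocVK X (ctx Γ ⊗ ctx Δ) (ctx Θ))).
  apply: (comp_cancelr
    (tens_inv (Eq_assocVK X (ctx Γ) (ctx Δ)) (Eq_comp1l (Id (ctx Θ))))).
  apply: (comp_cancell (Eq_assocK X (ctx Γ) (ctx Δ ⊗ ctx Θ))); norm.
  crw (Eq_assocVK X (ctx Γ) (ctx Δ ⊗ ctx Θ)).
  crw (Eq_assocK X (ctx Γ ⊗ ctx Δ) (ctx Θ)).
  rewrite tens_comp Eq_assocK Eq_comp1l Eq_tens1; norm.
  by rewrite Eq_pentagon compA.
have -> : (AssocV X (ctx Γ) (ctx Δ) ∘ (Id X ⊠ s)) ⊠ Id (ctx Θ)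
   ≡ (AssocV X (ctx Γ) (ctx Δ) ⊠ Id (ctx Θ)) ∘ ((Id X ⊠ s) ⊠ Id (ctx Θ)).
  by rewrite tens_comp Eq_comp1l.
norm; crw (assocV_nat (Id X) s (Id (ctx Θ))).
rewrite (comp_ext2 _ pent) !tens_comp !Eq_comp1l.
norm; rewrite tens_comp eP Eq_comp1l -Eq_tens1.
by crw (assocV_nat (Id X) (Id (ctx Γ)) (uncat Δ Θ)); rewrite tens_comp Eq_comp1l.
Qed.

Lemma uncat_assocV Γ Δ Θ : exists e : (Γ ++ Δ) ++ Θ = Γ ++ (Δ ++ Θ),
  AssocV (ctx Γ) (ctx Δ) (ctx Θ) ∘ ((Id (ctx Γ) ⊠ uncat Δ Θ) ∘
     (uncat Γ (Δ ++ Θ) ∘ castS e))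
  ≡ (uncat Γ Δ ⊠ Id (ctx Θ)) ∘ uncat (Γ ++ Δ) Θ.
Proof.
have [e eP] := uncat_assoc Γ Δ Θ; exists (esym e).
crwr eP; crw (Eq_assocK (ctx Γ) (ctx Δ) (ctx Θ)).
by rewrite castSK; norm.
Qed.

Fixpoint unflat A : term (ctx (flat A)) A :=
  match A return term (ctx (flat A)) A with
  | Gen p => RUnit (Gen p)
  | Unit => Id Unit
  | B ⊗ C => (unflat B ⊠ unflat C) ∘ uncat (flat B) (flat C)
  | Mon B => RUnit (Mon B)
  end.

Lemma unflat_inv A : exists v, unflat A ∘ v ≡ Id A.
Proof.
elim: A => [p||B [v vP] C [w wP]|A _] /=.
- by exists (RUnitV (Gen p)); rewrite Eq_runitVK.
- by exists (Id Unit); rewrite Eq_comp1l.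
- have [j jP] := uncat_inv (flat B) (flat C).
  by exists (j ∘ (v ⊠ w)); norm; crw jP; rewrite tens_inv.
- by exists (RUnitV (Mon A)); rewrite Eq_runitVK.
Qed.

(** The arrow that undoes the flattening of the first formula of a context; the
    premise of the left rule for [Mon A] lives on its source. *)
Definition unflat_head A Γ : term (ctx (flat A ++ Γ)) (A ⊗ ctx Γ) :=
  (unflat A ⊠ Id (ctx Γ)) ∘ uncat (flat A) Γ.

Lemma unflat_head_inv A Γ : exists v, unflat_head A Γ ∘ v ≡ Id (A ⊗ ctx Γ).
Proof.
have [v vP] := unflat_inv A; have [j jP] := uncat_inv (flat A) Γ.
exists (j ∘ (v ⊠ Id (ctx Γ))); rewrite /unflat_head; norm.
by crw jP; rewrite tens_inv ?Eq_comp1l.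
Qed.

(** * Normal forms *)

(** The strong Kleisli extension. *)
Definition lin A B C (h : term (A ⊗ C) (Mon B)) : term (Mon A ⊗ C) (Mon B) :=
  Mu B ∘ (MonA h ∘ Psi A C).

(** Cut-free proofs, presented as a predicate on the arrows that they denote and
    closed under equality of arrows. In [NF_lin] the context [Γ] is absorbed by
    the strength together with [Mon A]. *)
Inductive NF : forall Γ B, term (ctx Γ) B -> Prop :=
| NF_gen p : @NF [:: AGen p] (Gen p) (RUnit (Gen p))
| NF_unit : @NF [::] Unit (Id Unit)
| NF_tens Γ Δ B C (f : term (ctx Γ) B) (g : term (ctx Δ) C) :
    NF f -> NF g -> @NF (Γ ++ Δ) (B ⊗ C) ((f ⊠ g) ∘ uncat Γ Δ)
| NF_eta Γ B (f : term (ctx Γ) B) : NF f -> @NF Γ (Mon B) (Eta B ∘ f)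
| NF_lin A Γ B (h : term (A ⊗ ctx Γ) (Mon B)) :
    @NF (flat A ++ Γ) (Mon B) (h ∘ unflat_head A Γ) ->
    @NF (AMon A :: Γ) (Mon B) (lin h)
| NF_eq Γ B (f g : term (ctx Γ) B) : NF f -> f ≡ g -> NF g.

(** A single inversion principle for all targets; the match on the target avoids
    an equation between formulas, while the context is only known up to an
    equality, since a concatenation is not a pattern. *)
Lemma NF_inv Γ B (f : term (ctx Γ) B) : NF f ->
  match B return term (ctx Γ) B -> Prop with
  | Gen p => fun f => exists e : Γ = [:: AGen p], f ≡ RUnit (Gen p) ∘ castS e
  | Unit => fun f => exists e : Γ = [::], f ≡ castS e
  | B1 ⊗ B2 => fun f =>
    exists Γ1 Γ2 (e : Γ = Γ1 ++ Γ2) (f1 : term (ctx Γ1) B1) (f2 : term (ctx Γ2) B2),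
      [/\ NF f1, NF f2 & f ≡ ((f1 ⊠ f2) ∘ uncat Γ1 Γ2) ∘ castS e]
  | Mon B' => fun f =>
    (exists2 f' : term (ctx Γ) B', NF f' & f ≡ Eta B' ∘ f') \/
    exists A Γ' (e : Γ = AMon A :: Γ') (h : term (A ⊗ ctx Γ') (Mon B')),
      @NF (flat A ++ Γ') (Mon B') (h ∘ unflat_head A Γ') /\ f ≡ lin h ∘ castS e
  end f.
Proof.
elim=> {Γ B f} [p||Γ Δ B C f g nf _ ng _|Γ B f nf _|A Γ B h nh _|Γ B f g nf IH fg].
- by exists erefl; rewrite /= Eq_comp1r.
- by exists erefl.
- by exists Γ, Δ, erefl, f, g; split; rewrite //= Eq_comp1r.
- by left; exists f.
- by right; exists A, Γ, erefl, h; split; rewrite //= Eq_comp1r.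
case: B f g nf IH fg => [p||B C|B] f g nf + fg.
- by case=> e E; exists e; rewrite -fg.
- by case=> e E; exists e; rewrite -fg.
- by case=> Γ1 [Γ2 [e [f1 [f2 [? ? E]]]]]; exists Γ1, Γ2, e, f1, f2; split=> //; rewrite -fg.
- case=> [[f' ? E]|[A [Γ' [e [h [? E]]]]]].
    by left; exists f'; rewrite -?fg.
  by right; exists A, Γ', e, h; rewrite -fg.
Qed.

Lemma NF_cast Γ Γ' (e : Γ = Γ') B (f : term (ctx Γ') B) : NF f -> NF (f ∘ castS e).
Proof. by case: _ / e f => f nf; apply: NF_eq nf _; rewrite /= Eq_comp1r. Qed.

(** The conditions under which a property of normal forms with target [Mon B]
    holds for all of them: an induction on [NF] whose target stays fixed, since
    the premise of the left rule has the same target as its conclusion. *)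
Definition mon_closed B (Q : forall Γ, term (ctx Γ) (Mon B) -> Prop) : Prop :=
  [/\ forall Γ (f g : term (ctx Γ) (Mon B)), Q Γ f -> f ≡ g -> Q Γ g,
      forall Γ (f : term (ctx Γ) B), NF f -> Q Γ (Eta B ∘ f)
    & forall A Γ (h : term (A ⊗ ctx Γ) (Mon B)),
        Q (flat A ++ Γ) (h ∘ unflat_head A Γ) -> Q (AMon A :: Γ) (lin h)].

Lemma NF_mon_ind B (Q : forall Γ, term (ctx Γ) (Mon B) -> Prop) :
  mon_closed Q -> forall Γ (f : term (ctx Γ) (Mon B)), NF f -> Q Γ f.
Proof.
move=> Qc Γ f nf.
pose R Γ C := match C as C return term (ctx Γ) C -> Prop with
  | Mon C => fun f => forall Q, @mon_closed C Q -> Q Γ f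
  | _ => fun _ => True end.
suff : R Γ (Mon B) f by apply.
elim: nf => {Q Qc Γ f} // [Γ C f nf _|A Γ C h _ IH|Γ C f g _ + fg].
- by move=> Q [_ + _]; apply.
- by move=> Q Qc; case: (Qc) => _ _; apply; apply: IH.
- case: C f g fg => //= C f g fg IH Q Qc.
  by case: (Qc) => + _ _; apply; [apply: IH | apply: fg].
Qed.

(** * Closure of normal forms under composition with an arrow *)

#[local] Instance lin_proper A B C :
  Proper (@term_eq P (A ⊗ C) (Mon B) ==> @term_eq P (Mon A ⊗ C) (Mon B)) (@lin A B C).
Proof. by move=> h h' hh'; rewrite /lin hh'. Qed.

Lemma lin_comp A B C D (h : term (A ⊗ C) (Mon B)) (g : term D C) :
  lin (h ∘ (Id A ⊠ g)) ≡ lin h ∘ (Id (Mon A) ⊠ g).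
Proof.
rewrite /lin; norm; rewrite -mon_comp; norm.
by crw (Eq_psi_nat (Id A) g); rewrite Eq_mon1.
Qed.

Lemma mon_lin A B B' C (h : term (A ⊗ C) (Mon B)) (g : term B B') :
  MonA g ∘ lin h ≡ lin (MonA g ∘ h).
Proof. by rewrite /lin; crw (Eq_mu_nat g); rewrite -mon_comp; norm. Qed.

Lemma mu_lin A B C (h : term (A ⊗ C) (Mon (Mon B))) :
  Mu B ∘ lin h ≡ lin (Mu B ∘ h).
Proof. by rewrite /lin; crwr (Eq_mu_assoc B); rewrite -mon_comp; norm. Qed.

(** The fourth strength axiom moves [Psi] under [Mu], naturality moves it past
    [MonA h], and the first axiom merges the two strengths that then meet. *)
Lemma psi_lin A B C D E (h : term (A ⊗ C) (Mon B)) (g : term D E) :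
  Psi B E ∘ ((lin h ⊠ g) ∘ AssocV (Mon A) C D)
  ≡ lin (Psi B E ∘ ((h ⊠ g) ∘ AssocV A C D)).
Proof.
have -> : lin h ⊠ g ≡ (Mu B ⊠ Id E) ∘ ((MonA h ⊠ g) ∘ (Psi A C ⊠ Id D)).
  by rewrite !tens_comp Eq_comp1l Eq_comp1r.
norm; crw (Eq_psi_mu B E); crwr (Eq_psi_nat h g).
have -> : Psi (A ⊗ C) D ∘ ((Psi A C ⊠ Id D) ∘ AssocV (Mon A) C D)
    ≡ MonA (AssocV A C D) ∘ Psi A (C ⊗ D).
  apply: (comp_cancelr (Eq_assocVK (Mon A) C D)); norm; rewrite Eq_assocK; norm.
  crwr (Eq_psi_assoc A C D); rewrite Eq_compA mon_comp Eq_assocK Eq_mon1.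
  by norm.
by rewrite /lin -!mon_comp; norm.
Qed.

Lemma NF_linP A Γ B (h : term (A ⊗ ctx Γ) (Mon B)) f
    (g : term (ctx (AMon A :: Γ)) (Mon B)) :
  @NF (flat A ++ Γ) (Mon B) f -> f ≡ h ∘ unflat_head A Γ -> lin h ≡ g -> NF g.
Proof. by move=> nf fh; apply: (@NF_eq (AMon A :: Γ)); apply/NF_lin/(NF_eq nf). Qed.

(** Identity expansion: the identity of [Mon A] is the extension of [Eta A], by
    the right unit law of the monad and the unit axiom of the strength. *)
Lemma NF_unflat A : NF (unflat A).
Proof.
elim: A => [p||B nB C nC|A nA] /=; try by constructor.
have [e eP] := uncat_nil (flat A).
apply: (NF_linP (Γ := [::]) (h := Eta A ∘ RUnit A) (NF_cast e (NF_eta nA))).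
  rewrite -eP /unflat_head; norm.
  by crwr (Eq_runit_nat (unflat A)).
rewrite /lin -mon_comp; norm.
by crw (Eq_mu_mon_eta A); rewrite Eq_psi_unit.
Qed.

Lemma NF_mon_map B C (g : term B C) :
  (forall Γ (f : term (ctx Γ) B), NF f -> NF (g ∘ f)) ->
  forall Γ (f : term (ctx Γ) (Mon B)), NF f -> NF (MonA g ∘ f).
Proof.
move=> ng; apply: NF_mon_ind; split=> [Γ f f' nf ff'|Γ f nf|A Γ h nh].
- by apply: NF_eq nf _; rewrite ff'.
- by apply: NF_eq (NF_eta (ng _ _ nf)) _; crw (Eq_eta_nat g).
- apply: (NF_linP (h := MonA g ∘ h) nh); first by norm.
  by rewrite -mon_lin.
Qed.

Lemma NF_mu B Γ (f : term (ctx Γ) (Mon (Mon B))) : NF f -> NF (Mu B ∘ f).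
Proof.
move: Γ f; apply: NF_mon_ind; split=> [Γ f f' nf ff'|Γ f nf|A Γ h nh].
- by apply: NF_eq nf _; rewrite ff'.
- by apply: NF_eq nf _; crw (Eq_mu_eta B).
- apply: (NF_linP (h := Mu B ∘ h) nh); first by norm.
  by rewrite -mu_lin.
Qed.

(** The strength is pushed through the left rules of its first argument, whose
    contexts thereby absorb [Δ], until it meets an [Eta]. *)
Lemma NF_psi B C Δ (g : term (ctx Δ) C) : NF g ->
  forall Γ (f : term (ctx Γ) (Mon B)), NF f ->
  NF (Psi B C ∘ ((f ⊠ g) ∘ uncat Γ Δ)).
Proof.
move=> ng; apply: NF_mon_ind; split=> [Γ f f' nf ff'|Γ f nf|A Γ h nh].
- by apply: NF_eq nf _; rewrite ff'.
- apply: NF_eq (NF_eta (NF_tens nf ng)) _.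
  have -> : (Eta B ∘ f) ⊠ g ≡ (Eta B ⊠ Id C) ∘ (f ⊠ g).
    by rewrite tens_comp Eq_comp1l.
  by norm; crw (Eq_psi_eta B C).
rewrite /=.
have [e eP] := uncat_assocV (flat A) Γ Δ.
apply: (NF_linP (Γ := Γ ++ Δ) (h := Psi B C ∘ ((h ⊠ g) ∘
  (AssocV A (ctx Γ) (ctx Δ) ∘ (Id A ⊠ uncat Γ Δ)))) (NF_cast (esym e) nh)).
  rewrite /unflat_head; norm.
  have -> : (h ∘ ((unflat A ⊠ Id (ctx Γ)) ∘ uncat (flat A) Γ)) ⊠ g ≡
    (h ⊠ g) ∘ (((unflat A ⊠ Id (ctx Γ)) ⊠ Id (ctx Δ)) ∘
       (uncat (flat A) Γ ⊠ Id (ctx Δ))).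
    by rewrite !tens_comp !Eq_comp1r Eq_compA.
  norm; rewrite (comp_ext _ (Eq_sym eP)); norm; rewrite castSK; norm.
  crw (assocV_nat (unflat A) (Id (ctx Γ)) (Id (ctx Δ))).
  by rewrite Eq_tens1; fuse.
by rewrite -(compA (h ⊠ g)) -compA lin_comp -psi_lin; norm.
Qed.

(** By induction on [g], for all [f] at once, so that a composite [g] needs no
    argument. Each primitive arrow with a tensor product as source first inverts
    the right rule of the tensor in [f]. *)
Lemma NF_comp B C (g : term B C) Γ (f : term (ctx Γ) B) : NF f -> NF (g ∘ f).
Proof.
elim: g Γ f => {B C}.
- by move=> A Γ f nf; apply: NF_eq nf _; rewrite Eq_comp1l.
- by move=> A B C g IHg f IHf Γ k nk; apply: NF_eq (IHg _ _ (IHf _ _ nk)) _; norm.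
- move=> A B C D g IHg g' IHg' Γ f /NF_inv [Γ1 [Γ2 [e [f1 [f2 [n1 n2 E]]]]]].
  apply: NF_eq (NF_cast e (NF_tens (IHg _ _ n1) (IHg' _ _ n2))) _.
  by rewrite E -tens_comp; norm.
- by move=> A B g IHg Γ f; apply: NF_mon_map.
- move=> A B C Γ f /NF_inv [Γ' [Γ3 [eΓ [f' [f3 [n' n3 E]]]]]]; subst.
  move/NF_inv: n' E => [Γ1 [Γ2 [e [f1 [f2 [n1 n2 E']]]]]]; subst.
  rewrite /= => E; have [e eP] := uncat_assoc Γ1 Γ2 Γ3.
  apply: NF_eq (NF_cast (esym e) (NF_tens n1 (NF_tens n2 n3))) _.
  rewrite E E'; norm.
  have -> : ((f1 ⊠ f2) ∘ uncat Γ1 Γ2) ⊠ f3 ≡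
    ((f1 ⊠ f2) ⊠ f3) ∘ (uncat Γ1 Γ2 ⊠ Id (ctx Γ3)).
    by rewrite tens_comp Eq_comp1r.
  have -> : f1 ⊠ ((f2 ⊠ f3) ∘ uncat Γ2 Γ3) ≡
    (f1 ⊠ (f2 ⊠ f3)) ∘ (Id (ctx Γ1) ⊠ uncat Γ2 Γ3).
    by rewrite tens_comp Eq_comp1r.
  norm; rewrite (comp_ext _ (Eq_sym eP)); norm; rewrite castSK; norm.
  by crw (Eq_assoc_nat f1 f2 f3).
- move=> A B C Γ f /NF_inv [Γ1 [Γ' [eΓ [f1 [f' [n1 n' E]]]]]]; subst.
  move/NF_inv: n' E => [Γ2 [Γ3 [e [f2 [f3 [n2 n3 E']]]]]]; subst.
  rewrite /= => E; have [e eP] := uncat_assocV Γ1 Γ2 Γ3.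
  apply: NF_eq (NF_cast (esym e) (NF_tens (NF_tens n1 n2) n3)) _.
  rewrite E E'; norm.
  have -> : ((f1 ⊠ f2) ∘ uncat Γ1 Γ2) ⊠ f3 ≡
    ((f1 ⊠ f2) ⊠ f3) ∘ (uncat Γ1 Γ2 ⊠ Id (ctx Γ3)).
    by rewrite tens_comp Eq_comp1r.
  have -> : f1 ⊠ ((f2 ⊠ f3) ∘ uncat Γ2 Γ3) ≡
    (f1 ⊠ (f2 ⊠ f3)) ∘ (Id (ctx Γ1) ⊠ uncat Γ2 Γ3).
    by rewrite tens_comp Eq_comp1r.
  norm; rewrite (comp_ext _ (Eq_sym eP)); norm; rewrite castSK; norm.
  by crw (assocV_nat f1 f2 f3).
- move=> A Γ f /NF_inv [Γ1 [Γ2 [eΓ [f1 [f2 [/NF_inv [e E1] n2 E]]]]]]; subst.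
  apply: NF_eq n2 _; rewrite E E1 /=; norm.
  by crwr (Eq_lunit_nat f2); rewrite Eq_lunitVK; norm.
- move=> A Γ f nf; apply: NF_eq (NF_tens NF_unit nf) _.
  by rewrite /= lunitV_nat.
- move=> A Γ f /NF_inv [Γ1 [Γ2 [eΓ [f1 [f2 [n1 /NF_inv [e2 E2] E]]]]]]; subst.
  have [e eP] := uncat_nil Γ1.
  apply: NF_eq (NF_cast e n1) _; rewrite -eP E E2 /=; norm.
  by crw (Eq_runit_nat f1).
- move=> A Γ f nf; have [e eP] := uncat_nil Γ.
  apply: NF_eq (NF_cast (esym e) (NF_tens nf NF_unit)) _.
  rewrite -runitV_nat; norm; apply: Eq_comp => //.
  apply: (comp_cancell (Eq_runitK _)); rewrite Eq_runitVK.
  by crw eP; rewrite castSK.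
- by move=> A Γ f; apply: NF_eta.
- by move=> A Γ f; apply: NF_mu.
- move=> A B Γ f /NF_inv [Γ1 [Γ2 [eΓ [f1 [f2 [n1 n2 E]]]]]]; subst.
  by apply: NF_eq (NF_psi n2 n1) _; rewrite E /=; norm.
Qed.

(** * Normal forms are determined by their image in the simplicial category *)

Fixpoint countG A : nat :=
  match A with
  | Gen _ => 1
  | Unit => 0
  | B ⊗ C => countG B + countG C
  | Mon B => countG B
  end.

Lemma term_countG A B (f : term A B) : countG A = countG B.
Proof. by elim: f => {A B} //= *; lia. Qed.

Lemma countT_cat Γ Δ : countT (ctx (Γ ++ Δ)) = countT (ctx Δ) + countT (ctx Γ).
Proof. by elim: Γ => [|x Γ IH] /=; rewrite ?addn0 // IH addnA. Qed.

(** Every atom contains a generator or an occurrence of T, so the two counts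
    together determine where a list is cut. *)
Lemma cat_inj_count Γ Δ Γ' Δ' : Γ ++ Δ = Γ' ++ Δ' ->
  countT (ctx Γ) = countT (ctx Γ') -> countG (ctx Γ) = countG (ctx Γ') ->
  Γ = Γ' /\ Δ = Δ'.
Proof.
elim: Γ Γ' => [|x Γ IH] [|x' Γ'] //=.
- by move=> _; case: x' => [p|A] /=; lia.
- by move=> _; case: x => [p|A] /=; lia.
case=> <- e eT eG.
by have [] := IH Γ' e; [lia | lia | move=> -> ->].
Qed.

Lemma val_at_castS Γ Γ' (e : Γ = Γ') i : i < countT (ctx Γ) ->
  val_at (G_term (castS e)) i = i.
Proof. by case: _ / e => /= ?; rewrite val_at_id. Qed.

Lemma val_at_uncat Γ Δ i : i < countT (ctx (Γ ++ Δ)) ->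
  val_at (G_term (uncat Γ Δ)) i = i.
Proof.
elim: Γ i => [|x Γ IH] i /= lti; first by rewrite val_at_cast.
rewrite val_at_comp // val_at_juxt //.
case: ifPn => lt1; first by rewrite IH // val_at_cast // -countT_cat; lia.
rewrite val_at_id; last lia.
have -> : countT (ctx Δ) + countT (ctx Γ) + (i - countT (ctx (Γ ++ Δ))) = i.
  by move: lt1; rewrite countT_cat; lia.
by rewrite val_at_cast // -countT_cat.
Qed.

Lemma val_at_tens Γ Γ1 Γ2 (e : Γ = Γ1 ++ Γ2) B C (f1 : term (ctx Γ1) B)
    (f2 : term (ctx Γ2) C) i : i < countT (ctx Γ) ->
  val_at (G_term (((f1 ⊠ f2) ∘ uncat Γ1 Γ2) ∘ castS e)) i =
  if i < countT (ctx Γ2) then val_at (G_term f2) i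
  else countT C + val_at (G_term f1) (i - countT (ctx Γ2)).
Proof.
move=> lti /=; rewrite val_at_comp // val_at_castS //; subst.
by rewrite val_at_comp // val_at_uncat // val_at_juxt -?countT_cat.
Qed.

(** The occurrences of T in the right part are those whose image lies below
    [countT C]. If the two right parts had different numbers of them, the first
    occurrence in which they differ would be mapped both below and above. *)
Lemma G_tens_count Γ Γ1 Γ2 Δ1 Δ2 (e : Γ = Γ1 ++ Γ2) (d : Γ = Δ1 ++ Δ2) B C
    (f1 : term (ctx Γ1) B) (f2 : term (ctx Γ2) C)
    (g1 : term (ctx Δ1) B) (g2 : term (ctx Δ2) C) :
  G_term (((f1 ⊠ f2) ∘ uncat Γ1 Γ2) ∘ castS e) =
  G_term (((g1 ⊠ g2) ∘ uncat Δ1 Δ2) ∘ castS d) ->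
  countT (ctx Γ2) = countT (ctx Δ2).
Proof.
move=> eG; have E i : i < countT (ctx Γ) ->
    (if i < countT (ctx Γ2) then val_at (G_term f2) i
     else countT C + val_at (G_term f1) (i - countT (ctx Γ2))) =
    (if i < countT (ctx Δ2) then val_at (G_term g2) i
     else countT C + val_at (G_term g1) (i - countT (ctx Δ2))).
  by move=> lti; rewrite -(val_at_tens e) // eG val_at_tens.
have lf := @val_at_lt _ _ (G_term f2).
have lg := @val_at_lt _ _ (G_term g2).
have eT : countT (ctx Γ2) + countT (ctx Γ1) = countT (ctx Γ).
  by rewrite e countT_cat.
have dT : countT (ctx Δ2) + countT (ctx Δ1) = countT (ctx Γ).
  by rewrite d countT_cat.
case: (ltngtP (countT (ctx Γ2)) (countT (ctx Δ2))) => // lt.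
- have lt' : countT (ctx Γ2) < countT (ctx Γ) by lia.
  by move: (E _ lt') (lg _ lt); rewrite ltnn lt; lia.
- have lt' : countT (ctx Δ2) < countT (ctx Γ) by lia.
  by move: (E _ lt') (lf _ lt); rewrite ltnn lt; lia.
Qed.

Lemma G_tens_inj Γ Γ1 Γ2 (e : Γ = Γ1 ++ Γ2) B C (f1 g1 : term (ctx Γ1) B)
    (f2 g2 : term (ctx Γ2) C) :
  G_term (((f1 ⊠ f2) ∘ uncat Γ1 Γ2) ∘ castS e) =
  G_term (((g1 ⊠ g2) ∘ uncat Γ1 Γ2) ∘ castS e) ->
  G_term f1 = G_term g1 /\ G_term f2 = G_term g2.
Proof.
move=> eG.
have E i : i < countT (ctx Γ2) + countT (ctx Γ1) ->
    (if i < countT (ctx Γ2) then val_at (G_term f2) i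
     else countT C + val_at (G_term f1) (i - countT (ctx Γ2))) =
    (if i < countT (ctx Γ2) then val_at (G_term g2) i
     else countT C + val_at (G_term g1) (i - countT (ctx Γ2))).
  by rewrite -countT_cat -e => lti; rewrite -(val_at_tens e) // eG val_at_tens.
split; apply: val_atP => i lti.
- have := E (countT (ctx Γ2) + i); rewrite ltn_add2l lti.
  by rewrite ltnNge leq_addr /= addKn => /(_ isT); lia.
- by have := E i; rewrite ltn_addr // lti => /(_ isT).
Qed.

Lemma G_eta_inj A B (f g : term A B) :
  G_term (Eta B ∘ f) = G_term (Eta B ∘ g) -> G_term f = G_term g.
Proof.
move=> eG; apply: val_atP => i lti.
have := congr1 (fun h => val_at h i) eG; rewrite /= !val_at_comp //.
by rewrite !val_at_eta ?val_at_lt.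
Qed.

(** The function of [lin h] maps the greatest element to the greatest element,
    which is not a value of the function of an arrow through [Eta]. *)
Lemma G_eta_lin A B C (f : term (Mon A ⊗ C) B) (h : term (A ⊗ C) (Mon B)) :
  G_term (Eta B ∘ f) <> G_term (lin h).
Proof.
have lti : countT C + countT A < countT (Mon A ⊗ C) by rewrite /=; lia.
move/(congr1 (fun h => val_at h (countT C + countT A))); rewrite /=.
rewrite !val_at_comp // val_at_eta ?val_at_lt // val_at_cast //.
rewrite val_at_top // ltnn val_at_mu //.
by have := val_at_lt (G_term f) lti; rewrite /=; lia.
Qed.

(** The extension is determined by its restriction along [Eta]; this is what makes
    the premise of a left rule a function of its conclusion. *)
Lemma lin_eta A B C (h : term (A ⊗ C) (Mon B)) :
  lin h ∘ (Eta A ⊠ Id C) ≡ h.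
Proof.
rewrite /lin; norm; rewrite Eq_psi_eta; crw (Eq_eta_nat h).
by crw (Eq_mu_eta B).
Qed.

#[local] Instance G_term_proper A B : Proper (@term_eq P A B ==> eq) (@G_term P A B).
Proof. exact: G_term_eq. Qed.

Lemma G_comp_congr A B C (g g' : term B C) (f : term A B) :
  G_term g = G_term g' -> G_term (g ∘ f) = G_term (g' ∘ f).
Proof. by move=> /= ->. Qed.

Lemma G_lin_inj A B C (h h' : term (A ⊗ C) (Mon B)) :
  G_term (lin h) = G_term (lin h') -> G_term h = G_term h'.
Proof.
move=> eG; rewrite -(lin_eta h) -(lin_eta h'); exact: G_comp_congr.
Qed.

(** By induction on the normal form [f], inverting [g]. In the case of the left
    rule the premises are compared after composition with [unflat_head], which
    is cancelled because it has a right inverse. *)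
Lemma NF_unique Γ B (f g : term (ctx Γ) B) :
  NF f -> NF g -> G_term f = G_term g -> f ≡ g.
Proof.
move=> nf; elim: nf g => {Γ B f}.
- move=> p g /NF_inv [e ->] _.
  by rewrite castS_id Eq_comp1r.
- by move=> g /NF_inv [e ->] _; rewrite castS_id.
- move=> Γ1 Γ2 B C f1 f2 _ IH1 _ IH2 g /NF_inv [Δ1 [Δ2 [e [g1 [g2 [n1 n2 E]]]]]].
  rewrite E -(G_term_eq (Eq_comp1r ((f1 ⊠ f2) ∘ _))) => eG.
  have eT := @G_tens_count _ _ _ _ _ erefl e _ _ f1 f2 g1 g2 eG.
  have eT1 := congr1 (fun Γ => countT (ctx Γ)) e.
  have eG1 : countG (ctx Γ1) = countG (ctx Δ1).
    by rewrite (term_countG f1) (term_countG g1).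
  have [|? ?] := cat_inj_count e _ eG1; first by rewrite /= !countT_cat in eT1; lia.
  subst; rewrite castS_id in eG *.
  have [G1 G2] := @G_tens_inj _ _ _ erefl _ _ f1 g1 f2 g2 eG.
  by rewrite Eq_comp1r (IH1 _ n1 G1) (IH2 _ n2 G2).
- move=> Γ B f _ IH g /NF_inv [[g' ng E]|[A [Γ' [e [h [_ E]]]]]].
    by rewrite E => /G_eta_inj eG; rewrite (IH g').
  subst; rewrite E => eG; case: (@G_eta_lin _ _ _ f h).
  by rewrite eG; apply: G_term_eq; rewrite /= Eq_comp1r.
- move=> A Γ B h _ IH g /NF_inv [[g' ng E]|[A' [Γ' [e [h' [nh' E]]]]]].
    by rewrite E => /esym /G_eta_lin.
  case: (e) => eA eΓ; subst; rewrite castS_id Eq_comp1r in E.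
  rewrite E => eG.
  move/G_lin_inj: eG => eG.
  suff -> : h ≡ h' by [].
  have [v vP] := unflat_head_inv A' Γ'.
  by apply: (comp_cancelr vP); apply: IH; rewrite //= eG.
- by move=> Γ B f f' _ IH ff' g ng eG; rewrite -ff'; apply: IH; rewrite ?ff'.
Qed.

End Contexts.

(** Both arrows become normal forms after composition with [unflat A], which has
    a right inverse. *)
Theorem mainTheorem1 (P : Type) : faithful (G P).
Proof.
move=> A B f g /= eG.
have [v vP] := unflat_inv A; apply: (comp_cancelr vP).
apply: NF_unique; try exact/NF_comp/NF_unflat.
by rewrite /= eG.
Qed.
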